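(* Let $(\Omega,\mu,(\Pi_0,\Pi_1))$ be a finite information structure, $C\subseteq\Omega$ an event, $i\in\{0,1\}$ a player and $\omega\in\Omega$ a state. Then the value returned by $\text{common\_p\_belief}(C,i,\omega)$ is the maximum value of $p\in[0,1]$ such that at $\omega$ player $i$ $p$-believes that there is common $p$-belief in $C$, i.e. the maximum $p$ such that $P_i(\{\omega'\in\Omega:\text{the players have common } p\text{-belief in } C \text{ at } \omega'\}\mid\omega)\ge p$.
   Context: An information structure $(\Omega,\mu,(\Pi_0,\Pi_1))$ consists of a finite set $\Omega$ of states, a probability measure $\mu$ on $\Omega$, and two partitions $\Pi_0,\Pi_1$ of $\Omega$ (one per player $i\in\{0,1\}$). $\Pi_i(\omega)$ is the cell of $\Pi_i$ containing $\omega$; every cell is assumed to have positive $\mu$-measure. Events are subsets of $\Omega$. Put $P_i(E\mid\omega)=\mu(E\cap\Pi_i(\omega))/\mu(\Pi_i(\omega))$. Player $i$ $p$-believes an event $E$ at $\omega$ if $P_i(E\mid\omega)\ge p$. An event $E$ is a $p$-evident $C$-indicating event if for all $\omega\in E$ and all players $i$, $P_i(E\mid\omega)\ge p$ and $P_i(C\mid\omega)\ge p$. The players have common $p$-belief in $C$ at $\omega$ if there is a $p$-evident $C$-indicating event $E$ with $\omega\in E$. Algorithms. - $\text{min\_belief}(E,C,\omega)=\min_{i\in\{0,1\}}\min(P_i(E\mid\omega),P_i(C\mid\omega))$. - $\text{evidence\_level}(E,C)=\min_{\omega\in E}\text{min\_belief}(E,C,\omega)$ (called below only on nonempty $E$).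 - $\text{super\_p\_evident}(E,C,p)$: as long as there exists $\omega\in E$ with $\text{min\_belief}(E,C,\omega)\le p$ (for the current $E$), choose such an $\omega$ and replace $E$ by $E\setminus\{\omega\}$; when no such $\omega$ exists, return $E$. - $\text{common\_p\_belief}(C,i,\omega)$: set $E:=\Omega$, $F:=\Omega$. While $P_i(F\mid\omega)>0$: set $p:=\text{evidence\_level}(F,C)$, then $E:=F$, then $F:=\text{super\_p\_evident}(E,C,p)$. After the loop return $\text{evidence\_level}(E,C)$. *)

(* Defs.v *)
From Stdlib Require Import Relation_Operators.
From mathcomp Require Import all_boot all_order all_algebra.

Set Implicit Arguments.
Unset Strict Implicit.
Unset Printing Implicit Defensive.

Import Order.TTheory GRing.Theory Num.Theory.
Local Open Scope ring_scope.

(* The probability measure is given by its mass function [mu]. *)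
Record infoStruct (R : realFieldType) (Omega : finType) := InfoStruct {
  mu : Omega -> R;
  Pi : 'I_2 -> {set {set Omega}};
  mu_ge0 : forall w, 0 <= mu w;
  mu_sum1 : \sum_w mu w = 1;
  Pi_partition : forall i, partition (Pi i) [set: Omega];
  Pi_pos : forall i B, B \in Pi i -> 0 < \sum_(w in B) mu w
}.

Definition is_maximum (R : realFieldType) (A : R -> Prop) (m : R) : Prop :=
  A m /\ forall x, A x -> x <= m.

(* Nondeterministic loops: [halts step s] says that every sequence of steps
   from [s] is finite. *)
Definition halts (T : Type) (step : T -> T -> Prop) (s : T) : Prop :=
  Acc (fun t u => step u t) s.

Section Beliefs.

Variables (R : realFieldType) (Omega : finType) (S : infoStruct R Omega).
Implicit Types (E F C : {set Omega}) (i : 'I_2) (w : Omega) (p v : R).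

Definition Pr E : R := \sum_(w in E) mu S w.

Definition cell i w : {set Omega} := pblock (Pi S i) w.

Definition belief i E w : R := Pr (E :&: cell i w) / Pr (cell i w).

Definition p_believes p i E w : bool := p <= belief i E w.

Definition p_evident_indicating p C E : bool :=
  [forall w in E, forall i : 'I_2, p_believes p i E w && p_believes p i C w].

Definition common_belief_at p C w : bool :=
  [exists E : {set Omega}, p_evident_indicating p C E && (w \in E)].

Definition common_belief_event p C : {set Omega} :=
  [set w | common_belief_at p C w].

Definition min_belief E C w : R :=
  Num.min (Num.min (belief 0 E w) (belief 0 C w))
          (Num.min (belief 1 E w) (belief 1 C w)).

(* All beliefs are at most 1, so for nonempty [E] the default value 1 does not
   affect the minimum. *)
Definition evidence_level E C : R :=
  \big[Num.min/1]_(w in E) min_belief E C w.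

(* The algorithms are relations between inputs and outputs, because
   [super_p_evident] removes an arbitrary admissible state at each step. *)
Definition removal_step C p E E' : Prop :=
  exists w, [/\ w \in E, min_belief E C w <= p & E' = E :\ w].

Definition super_p_evident E C p E' : Prop :=
  clos_refl_trans _ (removal_step C p) E E' /\
  ~ exists E'', removal_step C p E' E''.

(* One execution of the body of the while loop, on the pair (E, F). *)
Definition loop_step C i w (s s' : {set Omega} * {set Omega}) : Prop :=
  [/\ 0 < belief i s.2 w,
      s'.1 = s.2 &
      super_p_evident s'.1 C (evidence_level s.2 C) s'.2].

Definition common_p_belief_returns C i w v : Prop :=
  exists E F,
    [/\ clos_refl_trans _ (loop_step C i w) ([set: Omega], [set: Omega]) (E, F),
        ~~ (0 < belief i F w) &
        v = evidence_level E C].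

(* No run is infinite, whatever states are chosen: neither the inner loops
   nor the outer one. *)
Definition common_p_belief_halts C i w : Prop :=
  (forall p E, halts (removal_step C p) E) /\
  halts (loop_step C i w) ([set: Omega], [set: Omega]).

End Beliefs.

(* Main.v *)
Require Import Defs.
From Stdlib Require Import Relation_Operators.
From mathcomp Require Import all_boot all_order all_algebra.

Set Implicit Arguments.
Unset Strict Implicit.
Unset Printing Implicit Defensive.

Import Order.TTheory GRing.Theory Num.Theory.
Local Open Scope ring_scope.

(** A nonempty event E is p-evident C-indicating exactly when p is at most its
    evidence level, and for p greater than the current evidence level no state
    of the largest p-evident C-indicating event is ever removed.  Hence along
    the outer loop the event of common p-belief stays inside F for every p
    above the evidence level of E.  When player i stops considering F possible,
    no such p can be believed, while the evidence level of E itself is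
    believed because E still meets the cell of i. *)

Lemma halts_of_measure (T : Type) (step : T -> T -> Prop) (m : T -> nat) s :
  (forall t u, step t u -> (m u < m t)%N) -> halts step s.
Proof.
move=> lt_m; have [n] := ubnP (m s).
elim: n s => [s|n IHn s lt_s]; first by rewrite ltn0.
constructor=> u /lt_m lt_us.
by apply: IHn; apply: leq_trans lt_us _.
Qed.

Section Beliefs.

Variables (R : realFieldType) (Omega : finType) (S : infoStruct R Omega).
Implicit Types (C E F : {set Omega}) (i : 'I_2) (w : Omega) (p : R).

(** * Conditional beliefs and their monotonicity *)

Lemma Pr_ge0 E : 0 <= Pr S E.
Proof. by apply: sumr_ge0 => x _; apply: mu_ge0. Qed.

Lemma Pr_subset E F : E \subset F -> Pr S E <= Pr S F.
Proof.
move=> sEF; rewrite /Pr [leRHS](big_setID E) /= (setIidPr sEF) lerDl.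
by apply: sumr_ge0 => x _; apply: mu_ge0.
Qed.

Lemma cover_Pi i w : w \in cover (Pi S i).
Proof. by rewrite (cover_partition (Pi_partition S i)) inE. Qed.

Lemma Pr_cell_gt0 i w : 0 < Pr S (cell S i w).
Proof. by apply: (@Pi_pos _ _ S i); apply: pblock_mem; apply: cover_Pi. Qed.

Lemma belief_subset i E F w : E \subset F -> belief S i E w <= belief S i F w.
Proof.
move=> sEF; rewrite ler_pM2r ?invr_gt0 ?Pr_cell_gt0 //.
by apply: Pr_subset; apply: setSI.
Qed.

Lemma belief_ge0 i E w : 0 <= belief S i E w.
Proof. by rewrite divr_ge0 ?Pr_ge0. Qed.

Lemma beliefT i w : belief S i [set: Omega] w = 1.
Proof. by rewrite /belief setTI divff // gt_eqF // Pr_cell_gt0. Qed.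

Lemma belief_le1 i E w : belief S i E w <= 1.
Proof. by rewrite -(beliefT i w) belief_subset ?subsetT. Qed.

Lemma belief_cell i E w x : x \in cell S i w -> belief S i E x = belief S i E w.
Proof.
move=> xw; have /and3P[_ triv _] := Pi_partition S i.
by rewrite /belief (_ : cell S i x = cell S i w) //; apply: same_pblock.
Qed.

Lemma belief_gt0_meets i E w :
  0 < belief S i E w -> exists2 x, x \in E & x \in cell S i w.
Proof.
case: (set_0Vmem (E :&: cell S i w)) => [E0|[x /setIP[]]]; last by exists x.
by rewrite /belief E0 /Pr big_set0 mul0r ltxx.
Qed.

Lemma le_min_belief p E C w :
  (p <= min_belief S E C w) =
  [forall i : 'I_2, p_believes S p i E w && p_believes S p i C w].
Proof.
rewrite /min_belief !le_min; apply/idP/forallP => [/andP[H0 H1] i|H].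
  by case: i => [[|[|//]] lti];
    [rewrite (_ : Ordinal lti = 0)|rewrite (_ : Ordinal lti = 1)] => //;
    apply: val_inj.
by apply/andP; split; apply: H.
Qed.

Lemma min_belief_ge0 E C w : 0 <= min_belief S E C w.
Proof. by rewrite /min_belief !le_min !belief_ge0. Qed.

Lemma min_belief_le1 E C w : min_belief S E C w <= 1.
Proof. by rewrite /min_belief !ge_min belief_le1. Qed.

Lemma min_belief_subset E F C w :
  E \subset F -> min_belief S E C w <= min_belief S F C w.
Proof.
move=> sEF; rewrite le_min_belief; apply/forallP => i.
(* Reflexivity is unfolded by [le_min_belief] into bounds for each player separately. *)
have: min_belief S E C w <= min_belief S E C w by [].
rewrite le_min_belief => /forallP/(_ i)/andP[HE ->]; rewrite andbT.
exact: le_trans HE (belief_subset _ _ sEF).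
Qed.

(** * Evidence levels and evident events *)

Lemma p_evidentE p C E :
  p_evident_indicating S p C E = [forall x in E, p <= min_belief S E C x].
Proof. by apply: eq_forallb => x; rewrite le_min_belief. Qed.

(** The bound [p <= 1] makes the default value 1 of the minimum harmless, in particular for empty
    [E]. *)
Lemma evidence_levelP p C E :
  p <= 1 -> (p <= evidence_level S E C) = p_evident_indicating S p C E.
Proof.
move=> p1; rewrite p_evidentE; apply/idP/forall_inP => [Hp x xE|H].
  by apply: le_trans Hp _; apply: bigmin_le_cond.
by apply/bigmin_geP; split.
Qed.

Lemma evidence_level_le1 C E : evidence_level S E C <= 1.
Proof. exact: bigmin_le_id. Qed.

Lemma evidence_level_ge0 C E : 0 <= evidence_level S E C.
Proof.
rewrite evidence_levelP // p_evidentE; apply/forall_inP => x _.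
exact: min_belief_ge0.
Qed.

Lemma evidence_level_attained C E x :
  x \in E ->
  exists2 y, y \in E & min_belief S E C y <= evidence_level S E C.
Proof.
move=> xE; apply/exists_inP; apply: contraT => /exists_inPn H.
have lt y : y \in E -> evidence_level S E C < min_belief S E C y.
  by move/H; rewrite -ltNge.
rewrite -(ltxx (evidence_level S E C)) {2}/evidence_level.
apply/bigmin_gtP; split=> //.
(* The default value 1 must also lie strictly above the level; the given element [x] of [E] ensures
   this. *)
exact: lt_le_trans (lt _ xE) (min_belief_le1 _ _ _).
Qed.

Lemma p_evident_sub_common p C E :
  p_evident_indicating S p C E -> E \subset common_belief_event S p C.
Proof.
move=> evE; apply/subsetP => x xE.
by rewrite inE; apply/existsP; exists E; rewrite evE.
Qed.

(** The event of common [p]-belief is the union of all [p]-evident [C]-indicating events, and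
    enlarging an event only raises [min_belief]. *)
Lemma common_belief_evident p C :
  p_evident_indicating S p C (common_belief_event S p C).
Proof.
rewrite p_evidentE; apply/forall_inP => x.
rewrite inE => /existsP[E /andP[evE xE]].
apply: le_trans (min_belief_subset C x (p_evident_sub_common evE)).
by move: evE; rewrite p_evidentE => /forall_inP; apply.
Qed.

(** * The inner loop *)

Lemma removal_step_card C p E E' : removal_step S C p E E' -> (#|E'| < #|E|)%N.
Proof. by case=> x [xE _ ->]; rewrite [ltnRHS](cardsD1 x) xE. Qed.

Lemma super_p_evident_exists C p E : exists E', super_p_evident S E C p E'.
Proof.
have: halts (removal_step S C p) E by apply: halts_of_measure (@removal_step_card C p).
elim=> {}E _ IH.
have [/exists_inP[x xE xp]|/exists_inPn none] :=
  boolP [exists x in E, min_belief S E C x <= p].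
  have rm : removal_step S C p E (E :\ x) by exists x.
  have [E' [runs stop]] := IH _ rm; exists E'; split=> //.
  exact: rt_trans (rt_step _ _ _ _ rm) runs.
exists E; split; first exact: rt_refl.
by case=> _ [x [xE xp _]]; have := none x xE; rewrite xp.
Qed.

Lemma super_p_evident_subset C p E E' : super_p_evident S E C p E' -> E' \subset E.
Proof.
case=> runs _; elim: runs => {E E'} [E _ [x [_ _ ->]]|//|E F G _ sFE _ sGF].
  exact: subD1set.
exact: subset_trans sGF sFE.
Qed.

Lemma super_p_evident_gt C p E E' x :
  super_p_evident S E C p E' -> x \in E' -> p < min_belief S E' C x.
Proof.
case=> _ stop xE'; rewrite ltNge; apply/negP => xp.
by apply: stop; exists (E' :\ x); exists x.
Qed.

(** As long as [G] lies in the current set, monotonicity gives each state of [G] a [min_belief] of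
    at least [q > p], so none of them can be removed next. *)
Lemma super_p_evident_keeps C p q E E' G :
  super_p_evident S E C p E' -> p < q -> p_evident_indicating S q C G ->
  G \subset E -> G \subset E'.
Proof.
case=> runs _ ltpq; rewrite p_evidentE => /forall_inP evG.
elim: runs => {E E'} [E _ [x [_ xp ->]] sGE|//|E F H _ IH1 _ IH2 /IH1/IH2 //].
rewrite subsetD1 sGE /=; apply/negP => /evG qx.
have := le_trans (le_trans qx (min_belief_subset C x sGE)) xp.
by rewrite leNgt ltpq.
Qed.

(** A state attaining the evidence level of [E] would be removable if [E'] were all of [E]. *)
Lemma super_evidence_level_proper C E E' x :
  x \in E -> super_p_evident S E C (evidence_level S E C) E' -> E' \proper E.
Proof.
move=> xE sup; rewrite properEneq (super_p_evident_subset sup) andbT.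
apply/eqP => eqE; have [y yE] := evidence_level_attained C xE.
rewrite leNgt -{2}eqE (super_p_evident_gt sup) //.
by rewrite eqE.
Qed.

(** * The outer loop: termination and correctness *)

Lemma loop_step_card C i w s s' : loop_step S C i w s s' -> (#|s'.2| < #|s.2|)%N.
Proof.
case=> /belief_gt0_meets[x xF _] ->.
by move/(super_evidence_level_proper xF)/proper_card.
Qed.

Lemma common_p_belief_terminates C i w : common_p_belief_halts S C i w.
Proof.
split=> [p E|]; first exact: halts_of_measure (@removal_step_card C p).
apply: (@halts_of_measure _ _ (fun s : {set Omega} * {set Omega} => #|s.2|)).
exact: loop_step_card.
Qed.

Lemma common_p_belief_defined C i w : exists v, common_p_belief_returns S C i w v.
Proof.
suff [E [F [runs stop]]] : exists E F,
    clos_refl_trans _ (loop_step S C i w) ([set: Omega], [set: Omega]) (E, F) /\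
    ~~ (0 < belief S i F w).
  by exists (evidence_level S E C), E, F.
have [_] := common_p_belief_terminates C i w.
elim=> {} s _ IH.
have [pos|stop] := boolP (0 < belief S i s.2 w); last first.
  by exists s.1, s.2; split=> //; case: s {IH stop} => E F; apply: rt_refl.
have [F' sup] := super_p_evident_exists C (evidence_level S s.2 C) s.2.
have st : loop_step S C i w s (s.2, F') by [].
have [E [F [runs stop]]] := IH _ st; exists E, F; split=> //.
exact: rt_trans (rt_step _ _ _ _ st) runs.
Qed.

(** The middle clause makes the thresholds of successive rounds nondecreasing, so that the last
    clause carries over from one round to the next. *)
Definition loop_invariant C i w (s : {set Omega} * {set Omega}) : Prop :=
  [/\ 0 < belief S i s.1 w,
      evidence_level S s.1 C <= evidence_level S s.2 C &
      forall p, evidence_level S s.1 C < p ->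
        common_belief_event S p C \subset s.2].

Lemma loop_invariant_init C i w :
  loop_invariant C i w ([set: Omega], [set: Omega]).
Proof.
by split=> [||p _] //=; rewrite beliefT.
Qed.

Lemma loop_invariant_step C i w s s' :
  loop_step S C i w s s' -> loop_invariant C i w s -> loop_invariant C i w s'.
Proof.
case: s s' => [E F] [E' F'] [/= pos -> sup] [/= _ incr keeps].
split=> [//||p ltp] /=.
  (* Every surviving state has [min_belief] above the threshold; if none survives, the level is the
     default 1. *)
  rewrite evidence_levelP ?evidence_level_le1 // p_evidentE.
  by apply/forall_inP => x xF'; apply: ltW (super_p_evident_gt sup xF').
apply: (super_p_evident_keeps sup ltp (common_belief_evident p C)).
(* Being above the new level, [p] is also above the previous one, so the old invariant applies. *)
by apply: keeps; apply: le_lt_trans ltp.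
Qed.

Lemma loop_invariant_run C i w s s' :
  clos_refl_trans _ (loop_step S C i w) s s' ->
  loop_invariant C i w s -> loop_invariant C i w s'.
Proof.
by elim=> {s s'} [s s'|//|s t u _ IH1 _ IH2 /IH1/IH2 //]; apply: loop_invariant_step.
Qed.

(** At a state of [E] in the cell of [w], player [i] believes [E] to at least its evidence level.
    Beliefs are constant on cells, and [E] lies in the event of common belief at that level. *)
Lemma believes_evidence_level C E i w :
  0 < belief S i E w ->
  p_believes S (evidence_level S E C) i
    (common_belief_event S (evidence_level S E C) C) w.
Proof.
move=> /belief_gt0_meets[x xE xw].
have evE : p_evident_indicating S (evidence_level S E C) C E.
  by rewrite -evidence_levelP ?evidence_level_le1.
apply: le_trans (belief_subset i w (p_evident_sub_common evE)).
by rewrite -(belief_cell E xw); have /forall_inP/(_ x xE)/forallP/(_ i)/andP[] := evE.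
Qed.

Lemma common_p_belief_correct C i w v :
  common_p_belief_returns S C i w v ->
  is_maximum
    (fun p => 0 <= p <= 1 /\ p_believes S p i (common_belief_event S p C) w) v.
Proof.
case=> E [F [runs stop ->]].
have [/= pos _ keeps] := loop_invariant_run runs (loop_invariant_init C i w).
split; first by rewrite evidence_level_ge0 evidence_level_le1 believes_evidence_level.
(* A believed [p] above the returned level would be positive and would bound the belief in [F] from
   below, against the exit condition. *)
move=> p [_ bel]; rewrite leNgt; apply: contra stop => ltp.
apply: lt_le_trans (belief_subset i w (keeps p ltp)).
exact: lt_le_trans (le_lt_trans (evidence_level_ge0 C E) ltp) bel.
Qed.

End Beliefs.

Theorem corollary3 (R : realFieldType) (Omega : finType)
    (S : infoStruct R Omega) (C : {set Omega}) (i : 'I_2) (w : Omega) :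
  [/\ common_p_belief_halts S C i w,
      exists v : R, common_p_belief_returns S C i w v &
      forall v : R, common_p_belief_returns S C i w v ->
        is_maximum
          (fun p : R => 0 <= p <= 1 /\
             p_believes S p i (common_belief_event S p C) w)
          v].
Proof.
split; first exact: common_p_belief_terminates.
  exact: common_p_belief_defined.
exact: common_p_belief_correct.
Qed.
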